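(* Let $\{a_j\}_{j\ge1}\subset\mathbb H_+$ be a sequence of quaternions such that $\sum_{j\ge1}\mathrm{Re}(a_j)<\infty$. Then the infinite $\star$-product $$B(p)=\prod^{\star}_{j\ge1}(p+\bar a_j)^{-\star}\star(p-a_j)$$ converges uniformly on the compact subsets of $\mathbb H_+$.
   Context: $\mathbb H$: quaternions; $\mathbb H_+=\{p\in\mathbb H:\mathrm{Re}\,p>0\}$; $\mathbb S$: the purely imaginary unit quaternions. Slice hyperholomorphic functions on $\mathbb H_+$ are of the form $f(x+Iy)=\alpha(x,y)+I\beta(x,y)$, $I\in\mathbb S$, with $\alpha,\beta$ $\mathbb H$-valued, $\alpha(x,-y)=\alpha(x,y)$, $\beta(x,-y)=-\beta(x,y)$, $\partial_x\alpha=\partial_y\beta$, $\partial_y\alpha=-\partial_x\beta$. For $g=\gamma+I\delta$ of the same form, $(f\star g)(x+Iy)=(\alpha\gamma-\beta\delta)+I(\alpha\delta+\beta\gamma)$; $f^{-\star}$ is the inverse for $\star$. For $a\in\mathbb H_+$, the Blaschke factor is $b_a(p)=(p+\bar a)^{-\star}\star(p-a)=(p^2+2\mathrm{Re}(a)p+|a|^2)^{-1}(p^2-a^2)$. $\prod^\star_{j\ge 1}$ is the limit of the ordered $\star$-products $b_{a_1}\star\cdots\star b_{a_N}$ as $N\to\infty$. *)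

(* Defs.v *)
From HB Require Import structures.
From mathcomp Require Import all_boot all_order all_algebra.
From mathcomp Require Import ring lra.
From mathcomp Require Import all_classical all_reals all_analysis.
Import Order.TTheory GRing.Theory Num.Theory numFieldNormedType.Exports.

Set Implicit Arguments.
Unset Strict Implicit.
Unset Printing Implicit Defensive.

Local Open Scope classical_set_scope.
Local Open Scope ring_scope.

(* Hamilton's quaternions, as a normed algebra over R with the Euclidean norm:
   Quat a b c d is a + b i + c j + d k. *)
Record quat (R : realType) := Quat { qre : R; qi : R; qj : R; qk : R }.

Section Quaternions.
Variable R : realType.
Implicit Types p q : quat R.

Definition quat_to_tuple p := (qre p, qi p, qj p, qk p).
Definition tuple_to_quat (t : R * R * R * R) : quat R :=
  let: (a, b, c, d) := t in Quat a b c d.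
Fact quat_to_tupleK : cancel quat_to_tuple tuple_to_quat.
Proof. by case. Qed.

HB.instance Definition _ := Choice.copy (quat R) (can_type quat_to_tupleK).

Definition qadd p q :=
  Quat (qre p + qre q) (qi p + qi q) (qj p + qj q) (qk p + qk q).
Definition qopp p := Quat (- qre p) (- qi p) (- qj p) (- qk p).
Definition qmul p q :=
  Quat (qre p * qre q - qi p * qi q - qj p * qj q - qk p * qk q)
       (qre p * qi q + qi p * qre q + qj p * qk q - qk p * qj q)
       (qre p * qj q - qi p * qk q + qj p * qre q + qk p * qi q)
       (qre p * qk q + qi p * qj q - qj p * qi q + qk p * qre q).
Definition qscale (x : R) p := Quat (x * qre p) (x * qi p) (x * qj p) (x * qk p).
Definition qnorm p := Num.sqrt (qre p ^+ 2 + qi p ^+ 2 + qj p ^+ 2 + qk p ^+ 2).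

Fact qaddA : associative qadd.
Proof. by case=> ? ? ? ? [? ? ? ?] [? ? ? ?]; rewrite /qadd /= !addrA. Qed.
Fact qaddC : commutative qadd.
Proof. by case=> a b c d [a' b' c' d']; congr Quat; exact: addrC. Qed.
Fact qadd0 : left_id (Quat 0 0 0 0) qadd.
Proof. by case=> a b c d; rewrite /qadd /= !add0r. Qed.
Fact qaddN : left_inverse (Quat 0 0 0 0) qopp qadd.
Proof. by case=> a b c d; rewrite /qadd /= !addNr. Qed.

HB.instance Definition _ :=
  GRing.isZmodule.Build (quat R) qaddA qaddC qadd0 qaddN.

Fact qmulA : associative qmul.
Proof.
by case=> ? ? ? ? [? ? ? ?] [? ? ? ?]; congr Quat; rewrite /=; ring.
Qed.
Fact qmul1q : left_id (Quat 1 0 0 0) qmul.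
Proof. by case=> ? ? ? ?; congr Quat; rewrite /=; ring. Qed.
Fact qmulq1 : right_id (Quat 1 0 0 0) qmul.
Proof. by case=> ? ? ? ?; congr Quat; rewrite /=; ring. Qed.
Fact qmulDl : left_distributive qmul +%R.
Proof.
by case=> ? ? ? ? [? ? ? ?] [? ? ? ?]; congr Quat; rewrite /=; ring.
Qed.
Fact qmulDr : right_distributive qmul +%R.
Proof.
by case=> ? ? ? ? [? ? ? ?] [? ? ? ?]; congr Quat; rewrite /=; ring.
Qed.
Fact qoner_neq0 : Quat 1 0 0 0 != 0 :> quat R.
Proof. by apply/eqP => -[] /eqP; rewrite oner_eq0. Qed.

HB.instance Definition _ := GRing.Zmodule_isNzRing.Build (quat R)
  qmulA qmul1q qmulq1 qmulDl qmulDr qoner_neq0.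

Fact qscaleA a b p : qscale a (qscale b p) = qscale (a * b) p.
Proof. by case: p => *; rewrite /qscale /= !mulrA. Qed.
Fact qscale1 : left_id 1 qscale.
Proof. by case=> *; rewrite /qscale /= !mul1r. Qed.
Fact qscaleDr : right_distributive qscale +%R.
Proof. by move=> x [? ? ? ?] [? ? ? ?]; congr Quat; rewrite /= mulrDr. Qed.
Fact qscaleDl p : {morph qscale^~ p : a b / a + b}.
Proof. by move=> a b; congr Quat; rewrite /= mulrDl. Qed.

HB.instance Definition _ := GRing.Zmodule_isLmodule.Build R (quat R)
  qscaleA qscale1 qscaleDr qscaleDl.

Fact qscaleAl (a : R) p q : a *: (p * q) = (a *: p) * q.
Proof. by case: p q => ? ? ? ? [? ? ? ?]; congr Quat; rewrite /=; ring. Qed.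
Fact qscaleAr (a : R) p q : a *: (p * q) = p * (a *: q).
Proof. by case: p q => ? ? ? ? [? ? ? ?]; congr Quat; rewrite /=; ring. Qed.

HB.instance Definition _ := GRing.Lmodule_isLalgebra.Build R (quat R) qscaleAl.
HB.instance Definition _ := GRing.Lalgebra_isAlgebra.Build R (quat R) qscaleAr.

Fact qnormD p q : qnorm (p + q) <= qnorm p + qnorm q.
Proof.
case: p q => a b c d [a' b' c' d']; rewrite /qnorm /=.
set A := a ^+ 2 + _ + _ + _; set B := a' ^+ 2 + _ + _ + _.
have A0 : 0 <= A by rewrite !addr_ge0 ?sqr_ge0.
have B0 : 0 <= B by rewrite !addr_ge0 ?sqr_ge0.
set s := a * a' + b * b' + c * c' + d * d'.
have cs : s <= Num.sqrt A * Num.sqrt B.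
  rewrite -sqrtrM // (le_trans (ler_norm _)) // -sqrtr_sqr ler_wsqrtr //.
  rewrite -subr_ge0.
  have -> : A * B - s ^+ 2 = (a * b' - b * a') ^+ 2 + (a * c' - c * a') ^+ 2
    + (a * d' - d * a') ^+ 2 + (b * c' - c * b') ^+ 2
    + (b * d' - d * b') ^+ 2 + (c * d' - d * c') ^+ 2.
    by rewrite /A /B /s; ring.
  by rewrite !addr_ge0 ?sqr_ge0.
rewrite -[leRHS]ger0_norm ?addr_ge0 ?sqrtr_ge0 // -sqrtr_sqr ler_wsqrtr //.
rewrite [leRHS]sqrrD !sqr_sqrtr //.
have -> : (a + a') ^+ 2 + (b + b') ^+ 2 + (c + c') ^+ 2 + (d + d') ^+ 2
  = A + s *+ 2 + B by rewrite /A /B /s; ring.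
by rewrite lerD2r lerD2l lerMn2r.
Qed.
Fact qnormZ (x : R) p : qnorm (x *: p) = `|x| * qnorm p.
Proof.
by rewrite /qnorm /= !exprMn -!mulrDr sqrtrM ?sqr_ge0 // sqrtr_sqr.
Qed.
Fact qnorm0_eq0 p : qnorm p = 0 -> p = 0.
Proof.
case: p => a b c d /eqP; rewrite /qnorm /= sqrtr_eq0 => h.
have {h} : a ^+ 2 + b ^+ 2 + c ^+ 2 + d ^+ 2 == 0.
  by rewrite eq_le h !addr_ge0 ?sqr_ge0.
rewrite !paddr_eq0 ?addr_ge0 ?sqr_ge0 // !sqrf_eq0.
by move=> /andP[/andP[/andP[/eqP-> /eqP->] /eqP->] /eqP->].
Qed.

HB.instance Definition _ := Lmodule_isNormed.Build R (quat R)
  qnormD qnormZ qnorm0_eq0.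

Definition qconj p := Quat (qre p) (- qi p) (- qj p) (- qk p).
Definition qim p := Quat 0 (qi p) (qj p) (qk p).

(* The imaginary units, and the open right half-space. *)
Definition qS : set (quat R) := [set I | qre I = 0 /\ `|I| = 1].
Definition Hplus : set (quat R) := [set p | 0 < qre p].

End Quaternions.

Section SliceFunctions.
Variable R : realType.
Implicit Types (f g : quat R -> quat R) (u v : R * R -> quat R).

(* Functions on Hplus are represented by total functions quat R -> quat R, and
   functions of (x, y) on the half-plane x > 0 by total functions on R * R; the
   values outside of these domains are irrelevant. *)
Definition is_stem f u v :=
  [/\ forall x y, 0 < x -> u (x, - y) = u (x, y),
      forall x y, 0 < x -> v (x, - y) = - v (x, y)
    & forall x y I, 0 < x -> qS I ->
        f (x%:A + y *: I) = u (x, y) + I * v (x, y)].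

Definition cauchy_riemann u v := forall z : R * R, 0 < z.1 ->
  [/\ differentiable u z, differentiable v z,
      'D_(1, 0) u z = 'D_(0, 1) v z & 'D_(0, 1) u z = - 'D_(1, 0) v z].

Definition slice_hyperholomorphic f :=
  exists u v, is_stem f u v /\ cauchy_riemann u v.

(* The stem (alpha, beta) of a slice function is unique on x > 0
   (see is_stem_uniq), hence the choice below is harmless. *)
Definition stem f : (R * R -> quat R) * (R * R -> quat R) :=
  get [set w | is_stem f w.1 w.2].

(* The function x + I y |-> u (x, y) + I v (x, y): a quaternion p is decomposed
   with x = Re p, y = |Im p| and I = Im p / |Im p|; for real p, I is 0, which is
   immaterial since v (x, 0) = 0 for odd v. *)
Definition slice_fun u v : quat R -> quat R := fun p =>
  let z := (qre p, `|qim p|) in u z + (`|qim p|^-1 *: qim p) * v z.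

Definition star f g : quat R -> quat R :=
  let: (alpha, beta) := stem f in
  let: (gamma, delta) := stem g in
  slice_fun (fun z => alpha z * gamma z - beta z * delta z)
            (fun z => alpha z * delta z + beta z * gamma z).

Lemma is_stem_uniq f u v u' v' : is_stem f u v -> is_stem f u' v' ->
  forall x y, 0 < x -> u (x, y) = u' (x, y) /\ v (x, y) = v' (x, y).
Proof.
move=> [_ _ fE] [_ _ fE'] x y x0.
pose I : quat R := Quat 0 1 0 0.
have II : I * I = -1 by congr Quat; rewrite /=; ring.
have SI : qS I.
  by split=> //; rewrite /Num.norm /= /qnorm /= expr0n expr1n add0r !addr0 sqrtr1.
have SNI : qS (- I) by case: SI => h n; split; rewrite ?normrN //= oppr0.
have e1 : u (x, y) + I * v (x, y) = u' (x, y) + I * v' (x, y).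
  by rewrite -fE // -fE'.
have e2 : u (x, y) - I * v (x, y) = u' (x, y) - I * v' (x, y).
  by rewrite -!mulNr -fE // -fE'.
have uE : u (x, y) = u' (x, y).
  have : 2 *: u (x, y) = 2 *: u' (x, y).
    rewrite !scaler_nat !mulr2n.
    have := congr2 +%R e1 e2.
    by rewrite addrACA subrr addr0 [RHS]addrACA subrr addr0.
  by move/scalerI; apply; rewrite pnatr_eq0.
split=> //; move: e1; rewrite uE => /addrI /(congr1 (fun q => - I * q)).
by rewrite !mulrA mulNr II opprK !mul1r.
Qed.

Lemma slice_fun_stem u v :
  (forall x y, 0 < x -> u (x, - y) = u (x, y)) ->
  (forall x y, 0 < x -> v (x, - y) = - v (x, y)) ->
  is_stem (slice_fun u v) u v.
Proof.
move=> ue vo; split=> // x y I x0 [I0 I1]; rewrite /slice_fun.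
have -> : qre (x%:A + y *: I) = x by rewrite /= I0; ring.
have -> : qim (x%:A + y *: I) = y *: I.
  by congr Quat; rewrite /= ?I0; ring.
rewrite normrZ I1 mulr1; have [y0|y0|->] := ltgtP y 0.
- rewrite ltr0_norm // ue // vo // scalerA invrN mulNr mulVf ?lt_eqF //.
  by rewrite scaleN1r mulrNN.
- by rewrite gtr0_norm // scalerA mulVf ?gt_eqF // scale1r.
- have v0 : v (x, 0) = 0.
    have /eqP := vo x 0 x0; rewrite oppr0 -subr_eq0 opprK -mulr2n -scaler_nat.
    by rewrite scaler_eq0 pnatr_eq0 => /eqP.
  by rewrite normr0 v0 !mulr0.
Qed.

Lemma star_stem f g alpha beta gamma delta :
  is_stem f alpha beta -> is_stem g gamma delta ->
  is_stem (star f g) (fun z => alpha z * gamma z - beta z * delta z)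
                     (fun z => alpha z * delta z + beta z * gamma z).
Proof.
move=> fs gs.
have sf : is_stem f (stem f).1 (stem f).2.
  by apply: (@getPex _ [set w | is_stem f w.1 w.2]); exists (alpha, beta).
have sg : is_stem g (stem g).1 (stem g).2.
  by apply: (@getPex _ [set w | is_stem g w.1 w.2]); exists (gamma, delta).
rewrite /star; case: (stem f) sf => a b /= sf; case: (stem g) sg => c d /= sg.
have [ae be _] := sf; have [ce de _] := sg.
have [||e o E] := @slice_fun_stem (fun z => a z * c z - b z * d z)
    (fun z => a z * d z + b z * c z).
- by move=> x y x0; rewrite ae // be // ce // de // mulrNN.
- by move=> x y x0; rewrite ae // be // ce // de // mulrN mulNr opprD.
have H x y x0 := is_stem_uniq fs sf (x := x) y x0.
have K x y x0 := is_stem_uniq gs sg (x := x) y x0.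
split=> [x y x0|x y x0|x y I x0 SI].
- by have [-> ->] := H x y x0; have [-> ->] := K x y x0;
    have [-> ->] := H x (- y) x0; have [-> ->] := K x (- y) x0; exact: e.
- by have [-> ->] := H x y x0; have [-> ->] := K x y x0;
    have [-> ->] := H x (- y) x0; have [-> ->] := K x (- y) x0; exact: o.
- by have [-> ->] := H x y x0; have [-> ->] := K x y x0; exact: E.
Qed.

Definition is_star_inverse f g :=
  slice_hyperholomorphic g /\
  forall p, Hplus p -> star f g p = 1 /\ star g f p = 1.

Definition star_inv f : quat R -> quat R := get (is_star_inverse f).

Definition blaschke (a : quat R) : quat R -> quat R :=
  star (star_inv (fun p => p + qconj a)) (fun p => p - a).

Definition star_prod (b : nat -> quat R -> quat R) (N : nat) :
    quat R -> quat R :=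
  \big[star/(fun=> 1)]_(0 <= j < N) b j.

Definition star_infprod (b : nat -> quat R -> quat R) : quat R -> quat R :=
  fun p => lim (star_prod b N p @[N --> \oo]).

End SliceFunctions.

(* Main.v *)
From HB Require Import structures.
Require Import Defs.
From mathcomp Require Import all_boot all_order all_algebra.
From mathcomp Require Import ring lra.
From mathcomp Require Import all_classical all_reals all_analysis.
Import Order.TTheory GRing.Theory Num.Theory numFieldNormedType.Exports.

Local Open Scope classical_set_scope.
Local Open Scope ring_scope.

(** Write [z = x + i y] and regard the values [alpha + i beta] of stems as
    elements of the complexified quaternions, where [i] is central. The star
    product of slice functions becomes the pointwise product of their stems in
    this algebra, and the stem of a Blaschke factor is
    [(z + conj a)^-1 (z - a)]. As [z - a = (z + conj a) - 2 Re a], this is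
    [1 - 2 Re(a) (z + conj a)^-1].

    Both [z + conj a] and [z - a] act by left multiplication as
    [(x + Re a) + S] and [(x - Re a) + S], where [S] is left multiplication by
    [i y - Im a], which is skew for the Euclidean inner product. Therefore
      |(z + conj a) w|^2 = |(z - a) w|^2 + 4 x Re(a) |w|^2
    ([sqn_zaddc_zsub]) and |(z + conj a) w| >= (x + Re a) |w|
    ([sqn_zaddc_ge]). The identity says that multiplication by the stem of a
    Blaschke factor is a contraction ([blaschke_contraction]); the inequality
    bounds the inverse by [1 / x], so that the factor differs from 1 by at most
    [2 Re(a) / x] ([blaschke_near1]), with no restriction on the size of [a].

    Consecutive partial products differ by [b_1 ... b_N (b_(N+1) - 1)]. The
    first [N] factors contract, so the difference is at most
    [2 Re(a_(N+1)) / x] on stems, and at most twice that on functions. On a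
    compact subset of the half-space [x] is bounded below, and the
    summability of the [Re(a_j)] gives uniform convergence by the Weierstrass
    test ([weierstrass_increments]), the quaternions being complete.

    That [star_inv] really yields the inverse of [p + conj a] requires an
    inverse that is slice hyperholomorphic. The explicit one,
    [(z^2 + 2 Re(a) z + |a|^2)^-1 (z + a)], combines the stem of a scalar
    holomorphic function with quaternionic constants, and the Cauchy-Riemann
    equations follow from their stability under sums, products and reciprocals
    of scalar functions. *)

(** * The quaternions as a complete normed algebra *)

Section QuatNorm.
Context {R : realType}.
Implicit Types p q : quat R.

Lemma sqr_normq p :
  `|p| ^+ 2 = qre p ^+ 2 + qi p ^+ 2 + qj p ^+ 2 + qk p ^+ 2.
Proof. by rewrite sqr_sqrtr // !addr_ge0 ?sqr_ge0. Qed.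

Lemma quat_eqP p q :
  [/\ qre p = qre q, qi p = qi q, qj p = qj q & qk p = qk q] -> p = q.
Proof. by case: p q => ? ? ? ? [? ? ? ?] /= [-> -> -> ->]. Qed.

Lemma normqM p q : `|p * q| = `|p| * `|q|.
Proof.
apply/eqP; rewrite -(@eqrXn2 _ 2) ?mulr_ge0 // exprMn !sqr_normq /=.
by apply/eqP; ring.
Qed.

Lemma normq_qre p : `|qre p| <= `|p|.
Proof.
rewrite -(@ler_pXn2r _ 2) ?nnegrE // real_normK ?num_real // sqr_normq.
by rewrite -!addrA lerDl !addr_ge0 ?sqr_ge0.
Qed.

(** Quaternionic coordinates are real parts of left multiples, so that bounds
    and limits of all four coordinates follow from those of the real part. *)
Lemma quat_coordE p :
  p = qre p *: 1 + qre (Quat 0 (-1) 0 0 * p) *: Quat 0 1 0 0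
    + qre (Quat 0 0 (-1) 0 * p) *: Quat 0 0 1 0
    + qre (Quat 0 0 0 (-1) * p) *: Quat 0 0 0 1.
Proof. by apply: quat_eqP; split; rewrite /=; ring. Qed.

Lemma qre_lipschitz c p q : `|qre (c * p) - qre (c * q)| <= `|c| * `|p - q|.
Proof.
rewrite -normqM mulrBr -[X in `|X| <= _]/(qre (c * p - c * q)).
exact: normq_qre.
Qed.

Lemma continuous_qre : continuous (@qre R).
Proof.
move=> p; apply/(@cvgrPdist_lt _ _ _ _ (nbhs_filter p)) => e e0.
apply: filterS (nbhsx_ballx p e e0) => q; rewrite -ball_normE /=.
by rewrite -[_ - qre q]/(qre (p - q)); exact: le_lt_trans (normq_qre _).
Qed.

Lemma quat_cauchy_cvg (F : set_system (quat R)) :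
  ProperFilter F -> cauchy F -> cvg F.
Proof.
move=> FF; rewrite -cauchy_ballP => cF.
have lc c : cvg (qre (c * q) @[q --> F]).
  apply/cauchy_cvgP/cauchy_ballP => e e0; rewrite near_map2.
  have ec : 0 < e / (`|c| + 1) by rewrite divr_gt0 // ltr_wpDl.
  apply: filterS (cF _ ec) => -[p q] /=.
  rewrite -!ball_normE /= ltr_pdivlMr ?ltr_wpDl // => h.
  apply: le_lt_trans (qre_lipschitz _ _ _) (le_lt_trans _ h).
  by rewrite mulrC ler_wpM2l // lerDl.
apply: (@cvgP _ _ (lim (qre (1 * q) @[q --> F]) *: 1
  + lim (qre (Quat 0 (-1) 0 0 * q) @[q --> F]) *: Quat 0 1 0 0
  + lim (qre (Quat 0 0 (-1) 0 * q) @[q --> F]) *: Quat 0 0 1 0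
  + lim (qre (Quat 0 0 0 (-1) * q) @[q --> F]) *: Quat 0 0 0 1)).
rewrite -[X in X --> _]/(id @ F) (_ : id = fun q => qre (1 * q) *: 1
  + qre (Quat 0 (-1) 0 0 * q) *: Quat 0 1 0 0
  + qre (Quat 0 0 (-1) 0 * q) *: Quat 0 0 1 0
  + qre (Quat 0 0 0 (-1) * q) *: Quat 0 0 0 1); last first.
  by apply/funext => q; rewrite mul1r; exact: quat_coordE.
by do 3![apply: cvgD; last exact: cvgZr_tmp (lc _)]; exact: cvgZr_tmp (lc _).
Qed.

End QuatNorm.

HB.instance Definition _ (R : realType) :=
  Uniform_isComplete.Build (quat R) quat_cauchy_cvg.

(** * A Weierstrass test *)

(** Uniform distances to the limit are controlled by the tails of the majorant:
    the increments telescope, and the bound passes to the limit. *)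
Lemma weierstrass_increments {R : realType} {V : completeNormedModType R}
    {T : choiceType} (F : nat -> T -> V) (M : nat -> R) (K : set T) :
  cvgn (series M) ->
  (forall n t, K t -> `|F n.+1 t - F n t| <= M n) ->
  {uniform K, F @ \oo --> (fun t => lim (F n t @[n --> \oo]))}.
Proof.
move=> cM FM.
have tele m n t : (m <= n)%N -> K t ->
    `|F n t - F m t| <= series M n - series M m.
  move=> mn Kt; rewrite -(telescope_sumr (F ^~ t)) // sub_series mn.
  by apply: le_trans (ler_norm_sum _ _ _) (ler_sum _ _) => i _; exact: FM.
have cF t : K t -> cvgn (F ^~ t).
  move=> Kt; pose u n := F n.+1 t - F n t.
  rewrite (_ : F ^~ t = fun n => F 0 t + series u n); last first.
    by apply/funext => n; rewrite /series /= telescope_sumr // subrKC.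
  apply: is_cvgD; [exact: is_cvg_cst | apply: normed_cvg].
  apply: series_le_cvg cM => n.
  - exact: normr_ge0.
  - by apply: le_trans (FM n t Kt).
  - exact: FM.
move=> P /uniform_nbhs[E [/= entE EP]].
move: entE; rewrite -entourage_ballE => -[e /= e0 eE].
suff : \forall n \near \oo, P (F n) by [].
near=> n; apply: EP => t Kt; apply: eE; rewrite /= -ball_normE /=.
apply: (@le_lt_trans _ _ (limn (series M) - series M n)).
  have cFn : cvgn (fun m => F m t - F n t).
    by apply: is_cvgB; [exact: cF | exact: is_cvg_cst].
  have -> : limn (F ^~ t) - F n t = limn (fun m => F m t - F n t).
    by rewrite limB ?lim_cst //; [exact: cF | exact: cvg_cst].
  rewrite -lim_norm //.
  have -> : limn (series M) - series M n =
      limn (fun m => series M m - series M n).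
    by rewrite limB ?lim_cst //; exact: cvg_cst.
  apply: ler_lim.
  - exact: is_cvg_norm.
  - by apply: is_cvgB => //; exact: is_cvg_cst.
  - by exists n => // m /= nm; exact: tele.
apply: le_lt_trans (ler_norm _) _.
by near: n; apply: cvgr_dist_lt.
Unshelve. all: by end_near. Qed.

(** * The algebra of values of stems *)

Section Stems.
Context {R : realType}.
Implicit Types (w : quat R * quat R) (a : quat R) (x y r c : R).

(** The pair [w] stands for [w.1 + i w.2] in the complexified quaternions, where
    [i] is central: the star product is the pointwise product of stems there. *)
Definition smul w w' : quat R * quat R :=
  (w.1 * w'.1 - w.2 * w'.2, w.1 * w'.2 + w.2 * w'.1).

(** The stems of [p + qconj a] and [p - a] at [x + i y]. *)
Definition zaddc x y a : quat R * quat R := (x%:A + qconj a, y%:A).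
Definition zsub x y a : quat R * quat R := (x%:A - a, y%:A).

Definition sqn w : R := `|w.1| ^+ 2 + `|w.2| ^+ 2.

Lemma sqn_ge0 w : 0 <= sqn w.
Proof. by rewrite addr_ge0 ?sqr_ge0. Qed.

Lemma sqnZ c w : sqn (c *: w) = c ^+ 2 * sqn w.
Proof. by rewrite /sqn /= !normrZ !exprMn real_normK ?num_real // mulrDr. Qed.

Lemma sqn1 : sqn (1, 0) = 1.
Proof. by rewrite /sqn !sqr_normq /=; ring. Qed.

Lemma smulA : associative smul.
Proof.
by move=> w1 w2 w3; congr (_, _); apply: quat_eqP; split; rewrite /=; ring.
Qed.

Lemma smul1w w : smul (1, 0) w = w.
Proof. by rewrite /smul /= !mul1r !mul0r subr0 addr0 -surjective_pairing. Qed.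

Lemma smulw1 w : smul w (1, 0) = w.
Proof. by rewrite /smul /= !mulr1 !mulr0 subr0 add0r -surjective_pairing. Qed.

Lemma smulBr w w1 w2 : smul w (w1 - w2) = smul w w1 - smul w w2.
Proof. by congr (_, _); apply: quat_eqP; split; rewrite /=; ring. Qed.

Lemma smulBl w w1 w2 : smul (w1 - w2) w = smul w1 w - smul w2 w.
Proof. by congr (_, _); apply: quat_eqP; split; rewrite /=; ring. Qed.

Lemma smulZr w c w' : smul w (c *: w') = c *: smul w w'.
Proof. by rewrite /smul /= -!scalerAr -scalerBr -scalerDr. Qed.

Lemma smulZl w c w' : smul (c *: w) w' = c *: smul w w'.
Proof. by rewrite /smul /= -!scalerAl -scalerBr -scalerDr. Qed.

Lemma zsubE x y a : zsub x y a = zaddc x y a - (2 * qre a) *: (1, 0).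
Proof.
congr (_, _); last by rewrite /= scaler0 subr0.
by apply: quat_eqP; split; rewrite /=; ring.
Qed.

(** Left multiplication by the imaginary unit and by purely imaginary
    quaternions is skew for the Euclidean product, hence only the real parts
    [x + Re a] and [x - Re a] enter the difference of the two energies. *)
Lemma sqn_zaddc_zsub x y a w :
  sqn (smul (zaddc x y a) w) =
  sqn (smul (zsub x y a) w) + 4 * x * qre a * sqn w.
Proof. by rewrite /sqn !sqr_normq /=; ring. Qed.

(** Same orthogonal decomposition: [zaddc x y a] is [x + Re a] plus a skew
    operator. *)
Lemma sqn_zaddc_ge x y a w :
  (x + qre a) ^+ 2 * sqn w <= sqn (smul (zaddc x y a) w).
Proof.
rewrite -subr_ge0.
rewrite (_ : _ - _ = sqn (smul (- qim a, y%:A) w)) ?sqn_ge0 //.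
by rewrite /sqn !sqr_normq /=; ring.
Qed.

Section Blaschke.
Variables (x y : R) (a : quat R) (h : quat R * quat R).
Hypotheses (x0 : 0 < x) (a0 : 0 < qre a).
Hypotheses (ch : smul (zaddc x y a) h = (1, 0)).
Hypotheses (hc : smul h (zaddc x y a) = (1, 0)).

Lemma smul_zsub_inv : smul h (zsub x y a) = (1, 0) - (2 * qre a) *: h.
Proof. by rewrite zsubE smulBr hc smulZr smulw1. Qed.

(** With [w = (z + conj a) w'], the factor sends [w] to [(z - a) w'], whose
    energy is smaller. *)
Lemma blaschke_contraction w :
  sqn (smul (smul h (zsub x y a)) w) <= sqn w.
Proof.
have -> : smul (smul h (zsub x y a)) w = smul (zsub x y a) (smul h w).
  by rewrite smul_zsub_inv zsubE !smulBl !smulZl smulA ch !smul1w.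
rewrite -[in leRHS](smul1w w) -ch -smulA sqn_zaddc_zsub lerDl.
by rewrite !mulr_ge0 ?sqn_ge0 ?ltW.
Qed.

(** [sqn_zaddc_ge] at [w = h] bounds the inverse of [z + conj a] by
    [1 / (x + Re a)]; weakening this to [1 / x] makes it uniform in [a]. *)
Lemma blaschke_near1 :
  sqn (smul h (zsub x y a) - (1, 0)) <= (2 * qre a / x) ^+ 2.
Proof.
rewrite smul_zsub_inv addrAC subrr add0r -scaleNr sqnZ sqrrN [leRHS]exprMn.
rewrite ler_wpM2l ?sqr_ge0 // exprVn -[leRHS]mul1r ler_pdivlMr ?exprn_gt0 //.
rewrite -sqn1 -ch; apply: le_trans (sqn_zaddc_ge _ _ _ _).
rewrite mulrC ler_wpM2r ?sqn_ge0 // ler_pXn2r ?nnegrE ?addr_ge0 ?ltW //.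
by rewrite ltrDl.
Qed.

End Blaschke.

End Stems.

(** * Slice functions and their stems *)

Section SliceStems.
Context {R : realType}.
Implicit Types (f g : quat R -> quat R) (u v : R * R -> quat R) (z : R * R).

Definition is_slice f := exists u v, is_stem f u v.

Definition stem_at f z : quat R * quat R := ((stem f).1 z, (stem f).2 z).

Lemma is_stem_stem f : is_slice f -> is_stem f (stem f).1 (stem f).2.
Proof.
move=> [u [v fuv]].
by apply: (@getPex _ [set w | is_stem f w.1 w.2]); exists (u, v).
Qed.

Lemma stem_atE f u v z : is_stem f u v -> 0 < z.1 -> stem_at f z = (u z, v z).
Proof.
case: z => x y fuv /= x0; have sf : is_slice f by exists u, v.
rewrite /stem_at.
by have [<- <-] := is_stem_uniq fuv (is_stem_stem _ sf) (x := x) y x0.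
Qed.

Lemma is_slice_star f g : is_slice f -> is_slice g -> is_slice (star f g).
Proof.
move=> [u [v fuv]] [u' [v' guv]]; do 2 eexists; exact: star_stem fuv guv.
Qed.

Lemma stem_at_star f g z : is_slice f -> is_slice g -> 0 < z.1 ->
  stem_at (star f g) z = smul (stem_at f z) (stem_at g z).
Proof.
move=> /is_stem_stem sf /is_stem_stem sg z0.
by rewrite (stem_atE _ _ _ _ (star_stem sf sg)).
Qed.

Lemma is_stem_1 : is_stem (fun=> 1 : quat R) (fun=> 1) (fun=> 0).
Proof. by split=> [||x y I _ _] *; rewrite ?oppr0 // mulr0 addr0. Qed.

Lemma is_stem_addc (a : quat R) :
  is_stem (fun p => p + qconj a) (fun z => (zaddc z.1 z.2 a).1)
                                 (fun z => (zaddc z.1 z.2 a).2).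
Proof.
split=> [//|x y _|x y I _ _] /=; first by rewrite scaleNr.
by rewrite -scalerAr mulr1 addrAC.
Qed.

Lemma is_stem_sub (a : quat R) :
  is_stem (fun p => p - a) (fun z => (zsub z.1 z.2 a).1)
                           (fun z => (zsub z.1 z.2 a).2).
Proof.
split=> [//|x y _|x y I _ _] /=; first by rewrite scaleNr.
by rewrite -scalerAr mulr1 addrAC.
Qed.

Lemma polar_form p : exists (y : R) I, qS I /\ p = (qre p)%:A + y *: I.
Proof.
have SI : qS (Quat 0 1 0 0 : quat R).
  split=> //=; apply/eqP; rewrite -(@eqrXn2 _ 2) // sqr_normq /=.
  by apply/eqP; ring.
have pE : p = (qre p)%:A + qim p by apply: quat_eqP; split; rewrite /=; ring.
have [im0|im0] := eqVneq (qim p) 0.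
  by exists 0, (Quat 0 1 0 0); split=> //; rewrite scale0r {1}pE im0.
exists `|qim p|, (`|qim p|^-1 *: qim p); split.
  split; first by rewrite /= mulr0.
  by rewrite normrZ normfV normr_id mulVf // normr_eq0.
by rewrite scalerA divff ?normr_eq0 // scale1r.
Qed.

(** A value [alpha + I beta] has norm at most [|alpha| + |beta|], whence the
    factor 2. *)
Lemma sqn_slice_dist f g p c : is_slice f -> is_slice g -> Hplus p -> 0 <= c ->
  (forall y, sqn (stem_at f (qre p, y) - stem_at g (qre p, y)) <= c ^+ 2) ->
  `|f p - g p| <= 2 * c.
Proof.
move=> /is_stem_stem[_ _ fE] /is_stem_stem[_ _ gE] p0 c0 fg.
have [y [I [SI pE]]] := polar_form p.
have /= := fg y; rewrite [in f p]pE [in g p]pE fE // gE //.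
rewrite opprD addrACA -mulrBr; set d1 := _ - (stem g).1 _.
set d2 := _ - (stem g).2 _ => dc.
apply: le_trans (ler_normD _ _) _.
rewrite normqM SI.2 mul1r mulr2n mulrDl mul1r.
by apply: lerD; rewrite -(@ler_pXn2r _ 2) ?nnegrE //;
  apply: le_trans dc; rewrite /sqn /= ?lerDl ?lerDr sqr_ge0.
Qed.

Lemma eq_stem_at f g z : is_slice f -> is_slice g -> 0 < z.1 ->
  (forall p, Hplus p -> f p = g p) -> stem_at f z = stem_at g z.
Proof.
move=> [u [v fuv]] sg z0 fg.
have gs := is_stem_stem _ sg; have [ge go gE] := gs.
rewrite (stem_atE f (stem g).1 (stem g).2) //; split=> // x y I x0 SI.
rewrite fg ?gE // /Hplus /=; case: SI => -> _; nra.
Qed.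

Lemma eq_on_Hplus f g p : is_slice f -> is_slice g -> Hplus p ->
  (forall z, 0 < z.1 -> stem_at f z = stem_at g z) -> f p = g p.
Proof.
move=> /is_stem_stem[_ _ fE] /is_stem_stem[_ _ gE] p0 fg.
have [y [I [SI pE]]] := polar_form p.
by rewrite pE fE // gE //; have [-> ->] := fg (qre p, y) p0.
Qed.

End SliceStems.

(** * Cauchy-Riemann pairs *)

Section CauchyRiemann.
Context {R : realType}.

Definition CR_at {V : normedModType R} (u v : R * R -> V) (z : R * R) :=
  [/\ differentiable u z, differentiable v z,
      'D_(1, 0) u z = 'D_(0, 1) v z & 'D_(0, 1) u z = - 'D_(1, 0) v z].

Lemma CR_at_cst {V : normedModType R} (c : V) z : CR_at (fun=> c) (fun=> 0) z.
Proof.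
by split; rewrite ?derive_cst ?oppr0 //; exact: differentiable_cst.
Qed.

Lemma CR_at_id z : CR_at fst snd z.
Proof.
have c1 : continuous (@fst R R) by move=> p; exact: cvg_fst.
have c2 : continuous (@snd R R) by move=> p; exact: cvg_snd.
have d1 : differentiable (@fst R R) z := @linear_differentiable _ _ _ fst z c1.
have d2 : differentiable (@snd R R) z := @linear_differentiable _ _ _ snd z c2.
split; [exact: d1 | exact: d2 | |].
  by rewrite (deriveE _ d1) (deriveE _ d2) (diff_lin _ c1) (diff_lin _ c2).
by rewrite (deriveE _ d1) (deriveE _ d2) (diff_lin _ c1) (diff_lin _ c2) oppr0.
Qed.

Lemma CR_atD {V : normedModType R} (u v u' v' : R * R -> V) z :
  CR_at u v z -> CR_at u' v' z ->
  CR_at (fun z => u z + u' z) (fun z => v z + v' z) z.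
Proof.
move=> [du dv e1 e2] [du' dv' e1' e2'].
have D w := @diff_derivable _ _ _ _ _ w du.
have Dv w := @diff_derivable _ _ _ _ _ w dv.
have D' w := @diff_derivable _ _ _ _ _ w du'.
have Dv' w := @diff_derivable _ _ _ _ _ w dv'.
split; try exact: differentiableD; rewrite !deriveD //.
  by rewrite e1 e1'.
by rewrite e2 e2' opprD.
Qed.

Lemma CR_atZl {V : normedModType R} (s t : R * R -> R) (q : V) z :
  CR_at s t z -> CR_at (fun z => s z *: q) (fun z => t z *: q) z.
Proof.
move=> [ds dt e1 e2].
have ds' := differentiableZl q ds; have dt' := differentiableZl q dt.
have DZ (f : R * R -> R) w : differentiable f z ->
    'D_w (fun z => f z *: q) z = 'D_w f z *: q.
  by move=> df; rewrite (deriveE _ (differentiableZl q df)) diffZl // deriveE.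
split; [exact: ds' | exact: dt' | |].
  by rewrite !DZ // e1.
by rewrite !DZ // e2 scaleNr.
Qed.

Lemma derive_mul (f g : R * R -> R) z w :
  differentiable f z -> differentiable g z ->
  'D_w (fun z => f z * g z) z = f z * 'D_w g z + g z * 'D_w f z.
Proof.
by move=> df dg; rewrite deriveM //; exact: diff_derivable.
Qed.

Lemma derive_inv (f : R * R -> R) z w :
  differentiable f z -> f z != 0 ->
  'D_w (fun z => (f z)^-1) z = - (f z) ^- 2 * 'D_w f z.
Proof.
by move=> df f0; rewrite deriveV //; exact: diff_derivable.
Qed.

Lemma CR_atM (s t s' t' : R * R -> R) z : CR_at s t z -> CR_at s' t' z ->
  CR_at (fun z => s z * s' z - t z * t' z) (fun z => s z * t' z + t z * s' z) z.
Proof.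
move=> [ds dt e1 e2] [ds' dt' e1' e2'].
have d1 := differentiableM ds ds'; have d2 := differentiableM dt dt'.
have d3 := differentiableM ds dt'; have d4 := differentiableM dt ds'.
have D f w := @diff_derivable _ _ _ f z w.
split; [exact: differentiableB d1 d2 | exact: differentiableD d3 d4 | |].
  rewrite deriveB ?deriveD; try exact: D.
  rewrite !derive_mul // e1 e1' e2 e2'.
  by move: ('D_(0, 1) t z) ('D_(0, 1) t' z) ('D_(1, 0) t z) ('D_(1, 0) t' z)
    => *; ring.
rewrite deriveB ?deriveD; try exact: D.
rewrite !derive_mul // e1 e1' e2 e2'.
by move: ('D_(0, 1) t z) ('D_(0, 1) t' z) ('D_(1, 0) t z) ('D_(1, 0) t' z)
  => *; ring.
Qed.

(** The reciprocal of [s + i t]. *)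
Lemma CR_atV (s t : R * R -> R) z : CR_at s t z -> s z * s z + t z * t z != 0 ->
  CR_at (fun z => s z * (s z * s z + t z * t z)^-1)
        (fun z => - (t z * (s z * s z + t z * t z)^-1)) z.
Proof.
move=> [ds dt e1 e2] n0; pose n (z : R * R) := s z * s z + t z * t z.
have dss := differentiableM ds ds; have dtt := differentiableM dt dt.
have dn : differentiable n z := differentiableD dss dtt.
have dV : differentiable (fun z => (n z)^-1) z := differentiableV dn n0.
have d1 := differentiableM ds dV; have d2 := differentiableM dt dV.
have D f w := @diff_derivable _ _ _ f z w.
have DnV w : 'D_w (fun z => (n z)^-1) z =
    - (n z) ^- 2 * (2 * s z * 'D_w s z + 2 * t z * 'D_w t z).
  rewrite derive_inv //; congr (_ * _); rewrite deriveD; try exact: D.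
  by rewrite !derive_mul // -!mulrA !mulr_natl !mulr2n.
split; [exact: d1 | exact: differentiableN d2 | |].
  rewrite deriveN; last exact: D.
  rewrite !derive_mul // !DnV e1 e2 /n.
  move: ('D_(0, 1) t z) ('D_(1, 0) t z) => u v; move: n0.
  by move: (s z) (t z) => a b n0; field.
rewrite deriveN ?opprK; last exact: D.
rewrite !derive_mul // !DnV e1 e2 /n.
move: ('D_(0, 1) t z) ('D_(1, 0) t z) => u v; move: n0.
by move: (s z) (t z) => a b n0; field.
Qed.

End CauchyRiemann.

(** * The star inverse of [p + conj a] *)

Section StarInverse.
Context {R : realType}.
Variable a : quat R.
Hypothesis a0 : 0 < qre a.
Implicit Types z : R * R.

(* [resol_re + i resol_im] is (z^2 + 2 Re(a) z + |a|^2)^-1 (z + a), expanded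
   along the real and imaginary parts [s], [t] of the quadratic polynomial and
   [P], [Q] of its reciprocal. *)
Let m2 := qi a ^+ 2 + qj a ^+ 2 + qk a ^+ 2.
Let s (z : R * R) :=
  (z.1 + qre a) * (z.1 + qre a) - z.2 * z.2 + m2.
Let t (z : R * R) := (z.1 + qre a) * z.2 + z.2 * (z.1 + qre a).
Let k (z : R * R) := (s z * s z + t z * t z)^-1.
Let P z := s z * k z.
Let Q z := - (t z * k z).

Definition resol_re (z : R * R) : quat R :=
  (P z * z.1 - Q z * z.2)%:A + P z *: a.
Definition resol_im (z : R * R) : quat R :=
  (P z * z.2 + Q z * z.1)%:A + Q z *: a.

(** The imaginary part [2 (x + Re a) y] of the quadratic polynomial vanishes for
    [y = 0] only, where the real part is positive. *)
Lemma resol_denom_neq0 z : 0 < z.1 -> s z * s z + t z * t z != 0.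
Proof.
move=> z0; have m0 : 0 <= m2 by rewrite !addr_ge0 ?sqr_ge0.
have r0 : 0 < z.1 + qre a by rewrite addr_gt0.
apply/eqP => st; have {st}[s0 t0] : s z = 0 /\ t z = 0.
  by move/eqP: st; rewrite paddr_eq0 -?expr2 ?sqr_ge0 // !sqrf_eq0 =>
    /andP[/eqP-> /eqP->].
have y0 : z.2 = 0.
  have tE : t z = z.2 * (2 * (z.1 + qre a)) by rewrite /t; ring.
  move/eqP: t0; rewrite tE mulf_eq0 => /orP[/eqP //|].
  by rewrite gt_eqF // mulr_gt0.
move: s0; rewrite /s y0 mulr0 subr0 => /eqP.
by rewrite gt_eqF // ltr_wpDr // mulr_gt0.
Qed.

Lemma CR_at_resol z : 0 < z.1 -> CR_at resol_re resol_im z.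
Proof.
move=> z0.
have CR_addc (u v : R * R -> R) c : CR_at u v z -> CR_at (fun z => u z + c) v z.
  move=> uv; rewrite (_ : v = fun z => v z + 0); last first.
    by apply/funext => w; rewrite addr0.
  by apply: CR_atD => //; exact: CR_at_cst.
have CRX : CR_at (fun z => z.1 + qre a) (fun z => z.2) z.
  by apply: CR_addc; exact: CR_at_id.
have CRs : CR_at s t z by apply: CR_addc; exact: CR_atM.
have CRP : CR_at P Q z := CR_atV s t z CRs (resol_denom_neq0 _ z0).
apply: CR_atD; apply: CR_atZl => //.
by apply: CR_atM => //; exact: CR_at_id.
Qed.

Lemma resol_stem : is_stem (slice_fun resol_re resol_im) resol_re resol_im.
Proof.
have sE x y : s (x, - y) = s (x, y) by rewrite /s /=; ring.
have tE x y : t (x, - y) = - t (x, y) by rewrite /t /=; ring.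
have PE x y : P (x, - y) = P (x, y) by rewrite /P /k sE tE mulrNN.
have QE x y : Q (x, - y) = - Q (x, y) by rewrite /Q /k sE tE mulrNN mulNr.
apply: slice_fun_stem => x y _; rewrite /resol_re /resol_im /= PE QE.
  by rewrite mulrNN.
by rewrite mulrN mulNr scaleNr -opprD scaleNr -opprD.
Qed.

Lemma smul_zaddc_resol z : 0 < z.1 ->
  smul (zaddc z.1 z.2 a) (resol_re z, resol_im z) = (1, 0).
Proof.
move=> z0; have n1 := mulfV (resol_denom_neq0 _ z0); rewrite -/(k z) in n1.
(* The product is the quadratic polynomial times [P + i Q]: only the real part
   of its first component uses the defining relation of [k]. *)
congr (_, _); apply: quat_eqP; last by split; rewrite /= /P /Q /s /t /m2; ring.
split; [rewrite -[RHS]/(1 : R) -n1 | idtac..]; rewrite /= /P /Q /s /t /m2; ring.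
Qed.

Lemma smul_resol_zaddc z : 0 < z.1 ->
  smul (resol_re z, resol_im z) (zaddc z.1 z.2 a) = (1, 0).
Proof.
move=> z0; have n1 := mulfV (resol_denom_neq0 _ z0); rewrite -/(k z) in n1.
congr (_, _); apply: quat_eqP; last by split; rewrite /= /P /Q /s /t /m2; ring.
split; [rewrite -[RHS]/(1 : R) -n1 | idtac..]; rewrite /= /P /Q /s /t /m2; ring.
Qed.

Let f (p : quat R) := p + qconj a.

Lemma is_slice_addc : is_slice f.
Proof. do 2 eexists; exact: is_stem_addc. Qed.

(** [star_inv] is a choice among inverses: the explicit slice function shows
    that there is one to choose. *)
Lemma star_invP : is_star_inverse f (star_inv f).
Proof.
have fs := is_stem_addc a; have gs := resol_stem.
have sf := is_slice_addc.
have sg : is_slice (slice_fun resol_re resol_im) by do 2 eexists; exact: gs.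
have s1 : is_slice (fun=> 1 : quat R) by do 2 eexists; exact: is_stem_1.
apply: (@getPex _ (is_star_inverse f)); exists (slice_fun resol_re resol_im).
split.
  exists resol_re, resol_im; split; first exact: gs.
  by move=> z z0; exact: CR_at_resol.
move=> p p0; split; apply: (eq_on_Hplus _ (fun=> 1)) => //;
  try exact: is_slice_star; move=> z z0; rewrite stem_at_star //.
  rewrite (stem_atE _ _ _ _ fs z0) (stem_atE _ _ _ _ gs z0).
  by rewrite (stem_atE _ _ _ _ is_stem_1 z0); exact: smul_zaddc_resol.
rewrite (stem_atE _ _ _ _ fs z0) (stem_atE _ _ _ _ gs z0).
by rewrite (stem_atE _ _ _ _ is_stem_1 z0); exact: smul_resol_zaddc.
Qed.

Lemma is_slice_star_inv : is_slice (star_inv f).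
Proof. by have [[u [v [uv _]]] _] := star_invP; exists u, v. Qed.

Lemma stem_at_star_inv z : 0 < z.1 ->
  smul (zaddc z.1 z.2 a) (stem_at (star_inv f) z) = (1, 0) /\
  smul (stem_at (star_inv f) z) (zaddc z.1 z.2 a) = (1, 0).
Proof.
move=> z0; have [_ inv1] := star_invP.
have sf := is_slice_addc; have sg := is_slice_star_inv.
have s1 : is_slice (fun=> 1 : quat R) by do 2 eexists; exact: is_stem_1.
have fE : stem_at f z = zaddc z.1 z.2 a by exact: stem_atE (is_stem_addc a) z0.
rewrite -fE -!stem_at_star // -(stem_atE _ _ _ _ is_stem_1 z0).
by split; apply: eq_stem_at => //; try exact: is_slice_star;
  move=> p /inv1[].
Qed.

Lemma is_slice_blaschke : is_slice (blaschke a).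
Proof.
apply: is_slice_star; first exact: is_slice_star_inv.
by do 2 eexists; exact: is_stem_sub.
Qed.

Lemma stem_at_blaschke z : 0 < z.1 -> stem_at (blaschke a) z =
  smul (stem_at (star_inv f) z) (zsub z.1 z.2 a).
Proof.
move=> z0; rewrite stem_at_star //; last by do 2 eexists; exact: is_stem_sub.
  by congr smul; exact: stem_atE (is_stem_sub a) z0.
exact: is_slice_star_inv.
Qed.

Lemma sqn_smul_blaschke z w : 0 < z.1 ->
  sqn (smul (stem_at (blaschke a) z) w) <= sqn w.
Proof.
move=> z0; have [ch hc] := stem_at_star_inv z z0.
by rewrite stem_at_blaschke //; exact: blaschke_contraction ch hc _.
Qed.

Lemma sqn_blaschke_sub1 z : 0 < z.1 ->
  sqn (stem_at (blaschke a) z - (1, 0)) <= (2 * qre a / z.1) ^+ 2.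
Proof.
move=> z0; have [ch hc] := stem_at_star_inv z z0.
by rewrite stem_at_blaschke //; exact: blaschke_near1 z0 a0 ch hc.
Qed.

End StarInverse.

(** * Products of Blaschke factors *)

Section StarProducts.
Context {R : realType}.
Implicit Types (b : nat -> quat R -> quat R) (z : R * R).

Lemma is_slice_star_prod b N :
  (forall j, is_slice (b j)) -> is_slice (star_prod b N).
Proof.
move=> sb; rewrite /star_prod; elim/big_ind: _ => //; last exact: is_slice_star.
by do 2 eexists; exact: is_stem_1.
Qed.

(** Folding the factors into operators acting on [w] from the left turns the
    comparison of two consecutive partial products into the comparison of the
    values of a single operator at two arguments. *)
Definition star_fold b z (js : seq nat) w :=
  foldr (fun j => smul (stem_at (b j) z)) w js.

Lemma stem_at_star_prod b N z : (forall j, is_slice (b j)) -> 0 < z.1 ->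
  stem_at (star_prod b N) z = star_fold b z (iota 0 N) (1, 0).
Proof.
move=> sb z0; rewrite /star_prod /index_iota subn0.
elim: (iota 0 N) => [|j js IH].
  by rewrite big_nil; exact: stem_atE is_stem_1 z0.
rewrite big_cons stem_at_star ?IH //.
by elim/big_ind: _ => //;
  [do 2 eexists; exact: is_stem_1 | exact: is_slice_star].
Qed.

Lemma sqn_star_fold_sub b z js w w' :
  (forall j v, sqn (smul (stem_at (b j) z) v) <= sqn v) ->
  sqn (star_fold b z js w - star_fold b z js w') <= sqn (w - w').
Proof.
move=> bc; elim: js => //= j js IH.
by rewrite -smulBr; exact: le_trans (bc _ _) IH.
Qed.

Lemma blaschke_prod_increment (a : nat -> quat R) N p :
  (forall j, Hplus (a j)) -> Hplus p ->
  `|star_prod (fun j => blaschke (a j)) N.+1 p -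
    star_prod (fun j => blaschke (a j)) N p| <= 2 * (2 * qre (a N) / qre p).
Proof.
move=> a0 p0; have sb j : is_slice (blaschke (a j)).
  exact: is_slice_blaschke _ (a0 j).
apply: sqn_slice_dist => //; try exact: is_slice_star_prod.
  by rewrite divr_ge0 ?mulr_ge0 ?ltW //; exact: a0.
move=> y; rewrite !stem_at_star_prod // -addn1 iotaD add0n /star_fold foldr_cat.
apply: le_trans (sqn_star_fold_sub _ _ _ _ _ _) _.
  by move=> j v; exact: sqn_smul_blaschke _ (a0 j) (qre p, y) v p0.
by rewrite /= smulw1; exact: sqn_blaschke_sub1 _ (a0 N) (qre p, y) p0.
Qed.

Lemma compact_Hplus_qre_ge (K : set (quat R)) : compact K -> K `<=` @Hplus R ->
  exists2 d : R, 0 < d & forall p, K p -> d <= qre p.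
Proof.
move=> cK KH; have [->|/set0P K0] := eqVneq K set0; first by exists 1.
have [c cK' cmin] :=
  compact_EVT_min K0 cK (continuous_subspaceT continuous_qre).
exists (qre c); first by apply: KH; exact: set_mem.
by move=> p Kp; apply: cmin; exact: mem_set.
Qed.

End StarProducts.

Theorem theorem4p11 (R : realType) (a : nat -> quat R) :
  (forall j : nat, Hplus (a j)) ->
  cvgn (series (fun j : nat => qre (a j))) ->
  forall K : set (quat R), compact K -> K `<=` @Hplus R ->
    {uniform K, star_prod (fun j : nat => blaschke (a j)) @ \oo -->
      star_infprod (fun j : nat => blaschke (a j))}.
Proof.
move=> a0 ca K cK KH; have [d d0 Kd] := compact_Hplus_qre_ge K cK KH.
apply: (weierstrass_increments _ (fun j => 4 / d * qre (a j))).
  exact: is_cvg_seriesZ ca.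
move=> n p Kp; apply: le_trans (blaschke_prod_increment _ _ _ a0 (KH _ Kp)) _.
rewrite (_ : 2 * _ = 4 * qre (a n) * (qre p)^-1); last by ring.
rewrite (_ : 4 / d * _ = 4 * qre (a n) * d^-1); last by ring.
apply: ler_wpM2l; first by rewrite mulr_ge0 // ltW //; exact: a0.
by rewrite lef_pV2 ?posrE //; [exact: Kd | exact: KH].
Qed.
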